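(* Let $\mathbb{C}$ be an initial configuration on $S$ stacks and let $F\cup G$ be a block subset satisfying P8 (with respect to a block $i$ in stack $s$). Then one can always pick exactly $S$ blocks out of $F\cup G$ forming a set that again satisfies P8, by the following procedure: (i) pick a block from stack $s$ (i.e. of $F$) that cannot be relocated to be WP in the verification step; (ii) pick a barrier block of the block picked in (i) from the first of the $S-1$ sorted stacks; (iii) pick a barrier block of the previously picked block from the second of the $S-1$ sorted stacks, and repeat this process until a block is picked from the last of the $S-1$ sorted stacks. (That is, all the required picks are possible, and the set of the $S$ picked blocks satisfies P8.)
   Context: Setting (block relocation problem). There are $S$ stacks and $B$ blocks labelled by $\mathbb{B}=\{1,\dots,B\}$; a smaller label means a higher priority. The initial configuration $\mathbb{C}$ places every block in exactly one stack, each stack being a finite vertical sequence of blocks. In a configuration, a block is badly placed (BP) if some block below it in the same stack has a smaller label; otherwise it is well placed (WP). The priority of a stack is the highest priority (smallest label) of a block in it, and $+\infty$ (the lowest priority) if it is empty. P8: a block set $F\cup G$ satisfies P8 with respect to a block $i$ in stack $s$ if: $F$ consists of blocks above $i$ in stack $s$ with priorities lower than that of $i$; $G$ consists of at most one WP block (with respect to $\mathbb{C}$) from each of the other $S-1$ stacks, each with priority lower than that of $i$; and, after removing from $\mathbb{C}$ all blocks except those of $F\cup G$, in every experiment in which each block of $F$ is relocated exactly once (from top to bottom, each to the top of one of the other $S-1$ stacks, without considering the stack height limit and without moving blocks of $G$), some relocated block fails to become WP. Verification step for $F\cup G$: remove from $\mathbb{C}$ all blocks except those of $F\cup G$. Sort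 the $S-1$ stacks other than $s$ in a non-decreasing order of their priorities, from the lowest priority (empty stacks first) to the highest priority. Then successively, from top to bottom, relocate the blocks of $F$ from stack $s$, ignoring the height limit: if the current block can be placed so as to be WP on at least one of the $S-1$ stacks, relocate it to the one of these stacks with the highest priority, i.e. the last one in the sorted order; if it cannot be relocated to be WP on any of them, stop (this is the block that cannot be relocated to be WP). Barrier blocks: for a block $j\in F$, a barrier block of $j$ is a block $k$ of higher priority than $j$ that is already piled in one of the $S-1$ other stacks at the moment when $j$ is to be relocated in the verification step. For a block $j\in G$, the barrier blocks of $j$ are the blocks of $G$ with priority higher than or equal to that of $j$. *)

(* Defs.v *)
From mathcomp Require Import all_boot all_order.

Set Implicit Arguments.
Unset Strict Implicit.
Unset Printing Implicit Defensive.

(* Stacks are 'I_S and blocks are 'I_B (the ordinal b is the label b + 1 of   *)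
(* {1, ..., B}); a smaller ordinal is a higher priority.  Every stack is      *)
(* listed from top to bottom.                                                 *)
Definition config (S B : nat) := 'I_S -> seq 'I_B.

Section BlockRelocation.

Variables S B : nat.
Implicit Types (C D : config S B) (s t : 'I_S) (b i j k : 'I_B).
Implicit Types (F G U : {set 'I_B}) (ord : seq 'I_S).

Definition initial_config C : Prop :=
  forall b, \sum_(s < S) count_mem b (C s) = 1.

Definition above D t j k : bool :=
  [&& j \in D t, k \in D t & index j (D t) < index k (D t)].

Definition BP D b : bool := [exists t, exists k, above D t b k && (k < b)].
Definition WP D b : bool := ~~ BP D b.

(* Labels are < B, so the value B, taken by the empty stack only, is +oo.     *)
Definition stack_priority D t : nat := \big[minn/B]_(b <- D t) b.

Definition keep C U : config S B := fun t => [seq b <- C t | b \in U].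

(* The block b, on top of stack s in every use below, goes on top of t.       *)
Definition relocate s t D b : config S B :=
  fun u => if u == s then rem b (D s) else if u == t then b :: D t else D u.

Definition experiment s (dest : 'I_B -> 'I_S) D : config S B :=
  foldl (fun E b => relocate s (dest b) E b) D (D s).

(* In keep C (F :|: G), stack s consists of the blocks of F.  A relocated     *)
(* block is tested for BP at the end of the experiment, which is the same as  *)
(* just after its relocation: the blocks below it never change afterwards.    *)
Definition P8 C i s F G : Prop :=
  [/\ i \in C s,
      forall b, b \in F -> above C s b i /\ i < b,
      forall b, b \in G -> [/\ b \notin C s, WP C b & i < b],
      forall t, t != s -> #|[set b in G | b \in C t]| <= 1
    & forall dest : 'I_B -> 'I_S, (forall b, b \in F -> dest b != s) ->
        exists2 b, b \in F & BP (experiment s dest (keep C (F :|: G))) b].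

(* The order of ties (several empty stacks) is left arbitrary.                *)
Definition sorted_stacks D s ord : Prop :=
  perm_eq ord [seq t <- enum 'I_S | t != s] /\
  sorted (fun t u => stack_priority D u <= stack_priority D t) ord.

Lemma sorted_stacks_exists D s : exists ord, sorted_stacks D s ord.
Proof.
exists (sort (fun t u => stack_priority D u <= stack_priority D t)
             [seq t <- enum 'I_S | t != s]).
split; first by rewrite perm_sort.
by apply: sort_sorted => t u; apply: leq_total.
Qed.

Definition WP_targets s ord D b : seq 'I_S :=
  [seq t <- ord | WP (relocate s t D b) b].

(* Stationary once stack s is empty or its top block has no target.           *)
Definition verification_step s ord D : config S B :=
  if D s is b :: _ then
    if WP_targets s ord D b is t :: ts then relocate s (last t ts) D b else D
  else D.

Definition verification C s ord F G (n : nat) : config S B :=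
  iter n (verification_step s ord) (keep C (F :|: G)).

Definition not_relocatable C s ord F G j : Prop :=
  exists n, let D := verification C s ord F G n in
    ohead (D s) = Some j /\ WP_targets s ord D j = [::].

(* k is a barrier block of j, and it is in stack t.                           *)
Definition barrier_in C s ord F G t j k : Prop :=
  (j \in F /\
   exists n, let D := verification C s ord F G n in
     [/\ ohead (D s) = Some j, k \in D t & k < j])
  \/
  (j \in G /\ [/\ k \in G, k \in C t & k <= j]).

(* The (possibly partial) sequences of successive picks; the block of index   *)
(* n.+1 is taken from the stack of index n of ord.                            *)
Inductive picks C s ord F G : seq 'I_B -> Prop :=
| Pick_first j :
    not_relocatable C s ord F G j -> picks C s ord F G [:: j]
| Pick_next ps j k :
    picks C s ord F G (rcons ps j) ->
    size ps < size ord ->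
    barrier_in C s ord F G (nth s ord (size ps)) j k ->
    picks C s ord F G (rcons (rcons ps j) k).

End BlockRelocation.

(* Main.v *)
(** A block of [F] is put by the greedy verification on the last of the sorted
    stacks that accepts it, so at that moment every later stack holds a block
    of higher priority; for a block of [G] the same follows from the sorting
    of the stacks.  Hence each pick can be continued on the next stack.  Along
    the picks the labels strictly decrease, the blocks of [F] come first and
    each is taken from above the previous one.  In any experiment on the [S]
    picked blocks, two of them end up on the same one of the [S - 1] stacks;
    the one picked earlier has the larger label and lies above the other
    (they cannot both be in [G]), so it is badly placed. *)
Require Import Defs.
From mathcomp Require Import all_boot all_order.

Set Implicit Arguments.
Unset Strict Implicit.
Unset Printing Implicit Defensive.

(** * Order of positions under filtering and reversal *)

Section SeqFacts.

Variable T : eqType.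
Implicit Types (x y : T) (l : seq T) (p : pred T).

Lemma ltn_index_filter p l x y :
  x \in filter p l -> y \in filter p l ->
  (index x (filter p l) < index y (filter p l)) = (index x l < index y l).
Proof.
elim: l => //= a l IHl; case: ifP => pa; rewrite ?inE /=.
  rewrite ![_ == a]eq_sym.
  by case: eqVneq => [<-|_] /=; case: eqVneq => [<-|_] //= xl yl; apply: IHl.
move=> xl yl; move: (xl) (yl); rewrite !mem_filter.
case: eqVneq => [<-|_]; first by rewrite pa.
by case: eqVneq => [<-|_]; rewrite ?pa // => _ _; apply: IHl.
Qed.

Lemma ltn_index_rev l x y : uniq l -> x \in l -> y \in l ->
  (index x (rev l) < index y (rev l)) = (index y l < index x l).
Proof.
elim: l => //= a l IHl /andP[al ul]; rewrite !inE ![_ == a]eq_sym.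
have hx z : a != z -> (a == z) || (z \in l) -> z \in l by case: eqVneq.
rewrite rev_cons -cats1 !index_cat !mem_rev /=.
case: (eqVneq a x) => [<-|ax]; case: (eqVneq a y) => [<-|ay] /=.
- by rewrite !ltnn.
- move=> _ yl; rewrite (negPf al) yl addn0 ltn0.
  by apply/negbTE; rewrite -leqNgt ltnW // index_mem mem_rev.
- move=> xl _; rewrite xl (negPf al) addn0.
  by rewrite index_mem mem_rev xl.
- by move=> xl yl; rewrite xl yl IHl.
Qed.

(** An accepted element after position [n] would move the end of the filtered list beyond
    [nth x0 l n]. With [p] the WP test, the stack that follows the greedy choice refuses the
    block. *)
Lemma after_last_filter p l ts (x0 : T) n :
  uniq l -> filter p l = rcons ts (nth x0 l n) -> n.+1 < size l ->
  ~~ p (nth x0 l n.+1).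
Proof.
move=> ul fE lt_n; apply/negP => pn.
move: (ul) fE; rewrite -{1 2}(cat_take_drop n.+1 l) cat_uniq filter_cat.
case/and3P=> _ /hasPn nmem _.
rewrite (drop_nth x0) //= pn => /(congr1 (last x0)).
rewrite last_rcons last_cat /= => eq_last.
have: nth x0 l n \in drop n.+1 l.
  rewrite -eq_last (drop_nth x0 lt_n) inE.
  have := mem_last (nth x0 l n.+1) [seq x <- drop n.+2 l | p x].
  by rewrite !inE mem_filter => /orP[->//|/andP[_ ->]]; rewrite orbT.
move/nmem/negP; apply.
by rewrite -(nth_take x0 (ltnSn n)) mem_nth // size_take lt_n.
Qed.

End SeqFacts.

(** * Relocations, experiments and the verification step on arbitrary configurations *)

Section Relocation.

Variables S B : nat.
Implicit Types (C D : config S B) (s t : 'I_S) (b i j k : 'I_B).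
Implicit Types (F G U : {set 'I_B}) (ord : seq 'I_S).

(** The part of [initial_config] that survives [keep], after which blocks may be missing. *)
Definition disjoint_stacks D : Prop :=
  (forall t, uniq (D t)) /\
  (forall b t u, b \in D t -> b \in D u -> t = u).

Lemma initial_config_disjoint C : initial_config C -> disjoint_stacks C.
Proof.
move=> hC; split=> [t|b t u bt bu].
  apply: count_mem_uniq => b.
  have := hC b; rewrite (bigD1 t) //=.
  case: (boolP (b \in C t)) => [|/count_memPn -> //].
  by rewrite -has_pred1 has_count; case: count => [|[|n]].
apply/eqP; apply/negPn/negP => ntu.
have := hC b; rewrite (bigD1 t) //= (bigD1 u) 1?eq_sym //=.
move: bt bu; rewrite -!has_pred1 !has_count.
by case: count => // m; case: count => // n _ _; rewrite !addSn addnS.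
Qed.

Lemma initial_config_mem C b : initial_config C -> exists t, b \in C t.
Proof.
move=> hC; case: (pickP (fun t => b \in C t)) => [t bt|none]; first by exists t.
by have := hC b; rewrite big1 // => t _; apply/count_memPn; rewrite none.
Qed.

Lemma keep_disjoint C U : disjoint_stacks C -> disjoint_stacks (keep C U).
Proof.
case=> uC dC; split=> [t|b t u]; first exact: filter_uniq.
by rewrite !mem_filter => /andP[_ bt] /andP[_ bu]; apply: dC bt bu.
Qed.

Lemma relocate_disjoint s t D b l :
  t != s -> D s = b :: l -> disjoint_stacks D ->
  disjoint_stacks (relocate s t D b).
Proof.
move=> nts Ds [uD dD].
have bnot u : u != s -> b \notin D u.
  by apply: contra => bu; apply/eqP/(dD b) => //; rewrite Ds mem_head.
have sub x u : x \in relocate s t D b u ->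
    if x == b then u = t else x \in D u.
  rewrite /relocate; case: eqP => [->|nus].
    have := uD s; rewrite Ds /= eqxx => /andP[bl _] xl.
    by case: eqP => [xb|_]; [rewrite -xb xl in bl | rewrite inE xl orbT].
  case: eqP => [->|nut].
    by rewrite inE; case: eqP.
  by case: eqP => [->|//] bu; move/eqP: nus => /bnot; rewrite bu.
split=> [u|x u v].
  rewrite /relocate; case: eqP => [_|_]; first exact: rem_uniq.
  by case: eqP => //= _; rewrite bnot ?uD.
move=> /sub xu /sub; move: xu.
by case: eqP => [_ -> ->|_ xu xv] //; apply: dD xu xv.
Qed.

(** By disjointness [b] occurs only on top of [t], so the blocks below it are exactly those of
    [D t]. *)
Lemma WP_relocate s t D b l :
  t != s -> D s = b :: l -> disjoint_stacks D ->
  WP (relocate s t D b) b = all (fun k => b <= k) (D t).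
Proof.
move=> nts Ds dD; have [uD' dD'] := relocate_disjoint nts Ds dD.
have Et : relocate s t D b t = b :: D t by rewrite /relocate (negPf nts) eqxx.
rewrite /WP; apply/idP/idP.
  move=> nBP; apply/allP => k kt; rewrite leqNgt; apply: contra nBP => lt_kb.
  apply/existsP; exists t; apply/existsP; exists k.
  rewrite lt_kb andbT /above Et !inE !eqxx kt orbT /=.
  by rewrite eqxx; case: eqP lt_kb => // ->; rewrite ltnn.
move/allP => h; apply/negP => /existsP[u /existsP[k /andP[/and3P[bu ku]]]].
have -> : u = t by apply: (dD' b) bu _; rewrite Et mem_head.
move: ku; have -> : u = t by apply: (dD' b) bu _; rewrite Et mem_head.
rewrite Et inE => /orP[/eqP->|/h le_bk _]; first by rewrite ltnn.
by rewrite ltnNge le_bk.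
Qed.

(** The reversal comes from moving the blocks from top to bottom: the last one moved ends on top. *)
Lemma experimentE s (dest : 'I_B -> 'I_S) D u :
  experiment s dest D u =
  if u == s then [::] else rev [seq b <- D s | dest b == u] ++ D u.
Proof.
rewrite /experiment; move El: (D s) => l.
elim: l D El => [|b l IHl] D Ds /=; first by case: eqP => // ->.
rewrite IHl; last by rewrite /relocate eqxx Ds /= eqxx.
case: eqP => // /eqP nus; rewrite /relocate (negPf nus) [u == _]eq_sym.
by case: eqP => [->|//]; rewrite rev_cons cat_rcons.
Qed.

(** The higher block [y] is moved first, so it ends below [x]. *)
Lemma above_experiment s dest D x y :
  uniq (D s) -> dest x != s -> dest y = dest x -> above D s y x ->
  above (experiment s dest D) (dest x) x y.
Proof.
move=> uD nxs eq_xy /and3P[ys xs lt_yx].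
rewrite /above experimentE (negPf nxs) !mem_cat !mem_rev !mem_filter.
rewrite eq_xy eqxx xs ys /= !index_cat !mem_rev !mem_filter eq_xy eqxx xs ys /=.
by rewrite ltn_index_rev ?filter_uniq // ?ltn_index_filter //
  mem_filter ?eq_xy eqxx.
Qed.

Lemma above_experiment_initial s dest D x y :
  dest x != s -> x \in D s -> y \notin D s -> y \in D (dest x) ->
  above (experiment s dest D) (dest x) x y.
Proof.
move=> nxs xs ys yt; rewrite /above experimentE (negPf nxs) !mem_cat !mem_rev.
rewrite !mem_filter eqxx xs yt orbT /= !index_cat !mem_rev !mem_filter.
rewrite eqxx xs (negPf ys) andbF /=.
by apply: ltn_addr; rewrite index_mem mem_rev mem_filter eqxx.
Qed.

(** The condition inside [not_relocatable], stated for any configuration as the induction on the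
    content of stack [s] requires. *)
Definition stuck s ord D j : Prop :=
  ohead (D s) = Some j /\ WP_targets s ord D j = [::].

Lemma verification_stepE s ord D b l ts t :
  D s = b :: l -> WP_targets s ord D b = rcons ts t ->
  verification_step s ord D = relocate s t D b.
Proof.
rewrite /verification_step => -> ->.
by case: ts => //= a ts; rewrite last_rcons.
Qed.

(** As long as the verification step finds targets, these build up an experiment that leaves every
    relocated block WP. P8 rules out the second alternative, which yields the first pick. *)
Lemma stuck_or_all_WP s ord D :
  s \notin ord -> disjoint_stacks D ->
  (exists n j, stuck s ord (iter n (verification_step s ord) D) j) \/
  exists dest : 'I_B -> 'I_S,
    forall b, b \in D s -> dest b != s /\ WP (experiment s dest D) b.
Proof.
move=> sord; move El: (D s) => l.
elim: l D El => [|b l IHl] D Ds dD; first by right; exists (fun _ => s).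
move ET: (WP_targets s ord D b) => w; case/lastP: w ET => [|ts t] ET.
  by left; exists 0, b; rewrite /stuck /= Ds.
have: t \in WP_targets s ord D b by rewrite ET mem_rcons mem_head.
rewrite mem_filter => /andP[wpb tord].
have nts : t != s by apply: contraNneq sord => <-.
have dD' := relocate_disjoint nts Ds dD.
have D's : relocate s t D b s = l by rewrite /relocate eqxx Ds /= eqxx.
have [[n [j hj]]|[dest hdest]] := IHl _ D's dD'.
  by left; exists n.+1, j; rewrite iterSr (verification_stepE Ds ET).
(* The block [b] follows the greedy choice [t], the others the destinations given by induction. *)
right; pose dest' x := if x == b then t else dest x.
exists dest'.
have bl : b \notin l by case: dD => /(_ s); rewrite Ds /= => /andP[].
have eqD u : experiment s dest' D u = experiment s dest (relocate s t D b) u.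
  rewrite !experimentE D's Ds; case: eqP => // /eqP nus /=.
  have -> : [seq x <- l | dest' x == u] = [seq x <- l | dest x == u].
    apply: eq_in_filter => x xl; rewrite /dest'.
    by case: (x =P b) bl => [<-|//]; rewrite xl.
  rewrite {1}/dest' eqxx /relocate (negPf nus) [u == t]eq_sym.
  by case: eqP => [->|//]; rewrite rev_cons cat_rcons.
have eqBP x : BP (experiment s dest' D) x
            = BP (experiment s dest (relocate s t D b)) x.
  by apply: eq_existsb => u; apply: eq_existsb => k; rewrite /above eqD.
move=> x; rewrite inE => /orP[/eqP->{x}|xl]; last first.
  have [nds wpx] := hdest x xl; rewrite /WP eqBP; split=> //.
  by rewrite /dest'; case: ifP.
rewrite {1}/dest' eqxx; split=> //.
move: wpb; rewrite (WP_relocate nts Ds dD) => /allP le_b.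
rewrite /WP eqBP; apply/negP => /existsP[u /existsP[k]].
rewrite /above experimentE D's; case: eqP => [//|/eqP nus].
set r := rev _; have br : b \notin r.
  by rewrite mem_rev mem_filter (negPf bl) andbF.
rewrite !mem_cat (negPf br) /= => /andP[/and3P[bu]].
have {bu nus}-> : u = t.
  have [_ dd] := dD'; apply: dd bu _.
  by rewrite /relocate (negPf nts) eqxx mem_head.
rewrite /relocate (negPf nts) eqxx !index_cat (negPf br) /= eqxx addn0.
(* A block of [r] is moved after [b] and lies above it, so only a block of [D t] could make [b]
   BP. *)
case: ifP => [kr _|_ /=]; first by rewrite ltnNge ltnW // index_mem.
rewrite inE => /orP[/eqP-> |/le_b le_bk] _; first by rewrite ltnn.
by rewrite ltnNge le_bk.
Qed.


(** Every label is below [B], so both sides are false for an empty stack. *)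
Lemma stack_priority_leq D t b :
  (stack_priority D t <= b) = has (fun k : 'I_B => k <= b) (D t).
Proof.
rewrite /stack_priority; elim: (D t) => [|k l IHl] /=.
  by rewrite big_nil leqNgt ltn_ord.
by rewrite big_cons geq_min IHl.
Qed.

End Relocation.

(** * The verification step under P8 *)

Section Verification.

Variables (S B : nat) (C : config S B) (i : 'I_B) (s : 'I_S).
Variables (F G : {set 'I_B}) (ord : seq 'I_S).
Hypothesis hC : initial_config C.
Hypothesis hP8 : P8 C i s F G.
Hypothesis hord : sorted_stacks (keep C (F :|: G)) s ord.

Local Notation K := (keep C (F :|: G)).
Local Notation V := (verification C s ord F G).

Lemma F_in_s b : b \in F -> b \in C s.
Proof. by case: hP8 => _ hF _ _ _ /hF[/and3P[]]. Qed.

Lemma G_notin_s b : b \in G -> b \notin C s.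
Proof. by case: hP8 => _ _ hG _ _ /hG[]. Qed.

Lemma F_notin_G b : b \in F -> b \notin G.
Proof. by move/F_in_s => bs; apply: contraL bs; apply: G_notin_s. Qed.

Lemma mem_ord t : (t \in ord) = (t != s).
Proof. by case: hord => /perm_mem -> _; rewrite mem_filter mem_enum andbT. Qed.

Lemma ord_uniq : uniq ord.
Proof. by case: hord => /perm_uniq -> _; rewrite filter_uniq ?enum_uniq. Qed.

Lemma size_ord : (size ord).+1 = S.
Proof.
case: hord => /perm_size -> _; rewrite size_filter.
rewrite -[RHS](size_enum_ord S) -(count_predC (pred1 s)).
by rewrite count_uniq_mem ?enum_uniq ?mem_enum.
Qed.

Lemma mem_keep_s b : (b \in K s) = (b \in F).
Proof.
rewrite mem_filter inE.
apply/idP/idP => [/andP[/orP[//|/G_notin_s/negP]]|bF] //.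
by rewrite bF F_in_s.
Qed.

Lemma mem_keep_other t b : t != s -> (b \in K t) = (b \in G) && (b \in C t).
Proof.
move=> nts; rewrite mem_filter inE.
case: (boolP (b \in C t)) => bt; rewrite ?andbF //.
rewrite !andbT; case: (boolP (b \in F)) => //= /F_in_s bs.
have [_ dC] := initial_config_disjoint hC.
by rewrite (dC b t s bt bs) eqxx in nts.
Qed.

Lemma above_keep l b l' x : K s = l ++ b :: l' -> x \in l' -> above C s b x.
Proof.
move=> Ks xl'.
have uK : uniq (K s) by apply: filter_uniq; case: (initial_config_disjoint hC).
have bK : b \in K s by rewrite Ks mem_cat mem_head orbT.
have xK : x \in K s by rewrite Ks mem_cat inE xl' !orbT.
move: (bK) (xK); rewrite !mem_filter /above => /andP[_ ->] /andP[_ ->] /=.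
rewrite -(ltn_index_filter bK xK) -/(keep _ _ s) Ks !index_cat.
move: uK; rewrite Ks cat_uniq /= negb_or.
case/and3P=> [_ /andP[bl /hasPn nl] /andP[bl' _]].
rewrite (negPf bl) (negPf (nl _ xl')) /= eqxx addn0.
by case: eqP bl' => [->|_ _]; rewrite ?xl' // addnS ltnS leq_addr.
Qed.

(** The state just before the move is recorded because the barrier blocks of [k] are judged in it;
    the [rcons] makes [t] the greedy choice. *)
Definition placed t k : Prop :=
  exists n l ts, V n s = k :: l /\ WP_targets s ord (V n) k = rcons ts t.

(** Stack [s] loses blocks only from its top, so a block of [F] already moved came from above all
    those still in [s]. *)
Lemma verification_inv n :
  [/\ disjoint_stacks (V n), exists l, K s = l ++ V n s
    & forall t k, t != s -> k \in V n t ->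
        (k \in G /\ k \in C t) \/
        [/\ k \in F, placed t k & forall x, x \in V n s -> above C s k x]].
Proof.
elim: n => [|n [dV [l0 Ks] origV]].
  split; first exact/keep_disjoint/initial_config_disjoint.
    by exists [::].
  by move=> t k nts; rewrite mem_keep_other // => /andP[]; left.
rewrite /verification iterS -/(V n).
(* The configuration is stationary when [s] is empty or its top block has no target. *)
case Vs: (V n s) => [|b l].
  have -> : verification_step s ord (V n) = V n.
    by rewrite /verification_step Vs.
  by split=> //; exists l0.
move ET: (WP_targets s ord (V n) b) => w; case/lastP: w ET => [|ts t0] ET.
  have -> : verification_step s ord (V n) = V n.
    by rewrite /verification_step Vs ET.
  by split=> //; exists l0.
have: t0 \in WP_targets s ord (V n) b by rewrite ET mem_rcons mem_head.
rewrite mem_filter mem_ord => /andP[_ nt0].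
rewrite (verification_stepE Vs ET).
have V's : relocate s t0 (V n) b s = l by rewrite /relocate eqxx Vs /= eqxx.
rewrite V's; rewrite Vs in Ks origV.
split; first exact: relocate_disjoint Vs dV.
  by exists (rcons l0 b); rewrite cat_rcons.
have old t k : t != s -> k \in V n t -> (k \in G /\ k \in C t) \/
    [/\ k \in F, placed t k & forall x, x \in l -> above C s k x].
  move=> nts /(origV _ _ nts)[|[kF pk ak]]; [by left | right; split=> // x xl].
  by apply: ak; rewrite inE xl orbT.
move=> t k nts; rewrite /relocate (negPf nts).
case: eqP => [->|_]; last exact: old.
rewrite inE => /orP[/eqP->|]; last exact: old.
right; split; first by rewrite -mem_keep_s Ks mem_cat mem_head orbT.
  by exists n, l, ts.
by move=> x; apply: above_keep Ks.
Qed.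

Lemma verification_s_F n b : b \in V n s -> b \in F.
Proof.
have [_ [l Ks] _] := verification_inv n.
by move=> bV; rewrite -mem_keep_s Ks mem_cat bV orbT.
Qed.

Lemma not_WP_barrier n t j l :
  V n s = j :: l -> t != s -> ~~ WP (relocate s t (V n) j) j ->
  exists k, barrier_in C s ord F G t j k.
Proof.
move=> Vs nts; have [dV _ _] := verification_inv n.
rewrite (WP_relocate nts Vs dV) => /allPn[k kt]; rewrite -ltnNge => lt_kj.
exists k; left; split.
  by apply: (@verification_s_F n); rewrite Vs mem_head.
by exists n; split; rewrite ?Vs.
Qed.

(** * Comparison of successive picks *)

Definition origin t k : Prop :=
  (k \in G /\ k \in C t) \/ (k \in F /\ placed t k).

(** Here [x] is the earlier pick. The implication also forbids a pick of [F] after one of [G]; it is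
    phrased so that the relation is transitive. *)
Definition pick_lt (x y : 'I_B) : bool :=
  (y < x) && ((y \in F) ==> (x \in F) && above C s y x).

Lemma pick_lt_trans : transitive pick_lt.
Proof.
move=> y x z /andP[yx hy] /andP[zy hz]; rewrite /pick_lt (ltn_trans zy yx) /=.
apply/implyP => zF; rewrite zF in hz; case/andP: hz => yF zay.
rewrite yF in hy; case/andP: hy => -> yax /=.
case/and3P: zay => zs ys zy'; case/and3P: yax => _ xs yx'.
by rewrite /above zs xs (ltn_trans zy' yx').
Qed.

(** Barriers within [G] allow equal labels; the hypothesis on [j] excludes [k = j] and makes the
    decrease strict. For [j] in [F], a barrier from [F] was moved earlier, hence came from above
    [j]. *)
Lemma barrier_inP t j k :
  t != s -> (j \in G -> j \notin C t) -> barrier_in C s ord F G t j k ->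
  pick_lt j k /\ origin t k.
Proof.
move=> nts jt [[jF [n [Vs kt lt_kj]]]|[jG [kG kt le_kj]]]; last first.
  split; last by left.
  rewrite /pick_lt ltn_neqAle le_kj andbT.
  rewrite (_ : k \in F = false) ?andbT; last first.
    by apply/negP => /F_notin_G; rewrite kG.
  by apply: contraNneq (jt jG) => /val_inj <-.
have jV : j \in V n s by case: (V n s) Vs => //= a l [->]; apply: mem_head.
have [_ _ /(_ t k nts kt)] := verification_inv n.
rewrite /pick_lt lt_kj jF => -[[kG kCt]|[kF pk ak]].
  split; last by left.
  by apply/implyP => /F_notin_G; rewrite kG.
by split; [rewrite ak // implybT | right].
Qed.

(** The number [m] counts the picks made before [j]; for positive [m], the block [j] comes from the
    stack of index [m - 1] in [ord]. *)
Definition last_pick (m : nat) j : Prop :=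
  if m is m'.+1 then m' < size ord /\ origin (nth s ord m') j
  else not_relocatable C s ord F G j.

Lemma last_pick_mem m j : last_pick m j -> j \in F :|: G.
Proof.
case: m => [|m] /=; rewrite inE; last by case=> _ [[->]|[->]]; rewrite ?orbT.
case=> n [Vs _]; rewrite (@verification_s_F n) //.
by case: (V n s) Vs => //= a l [->]; apply: mem_head.
Qed.

Lemma nth_ord m : m < size ord -> nth s ord m != s.
Proof. by move=> lt_m; rewrite -mem_ord mem_nth. Qed.

(** The first pick is in [F]; a later one in [G] lies in the preceding stack of [ord], which lists
    each stack once. *)
Lemma last_pick_G m j :
  last_pick m j -> m < size ord -> j \in G -> j \notin C (nth s ord m).
Proof.
case: m => [|m] /=.
  case=> n [Vs _] _ jG; have /F_notin_G : j \in F; last by rewrite jG.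
  apply: (@verification_s_F n).
  by case: (V n s) Vs => //= a l [->]; apply: mem_head.
case=> ltm [[jG jm]|[/F_notin_G/negP jF _]] // ltm1 _; apply/negP => jm1.
have [_ /(_ _ _ _ jm jm1)/eqP] := initial_config_disjoint hC.
by rewrite nth_uniq ?ord_uniq // eqn_leq ltnn andbF.
Qed.

Lemma last_pick_barrier m j :
  last_pick m j -> m < size ord ->
  exists k, barrier_in C s ord F G (nth s ord m) j k.
Proof.
case: m => [|m] /=.
  case=> n [Vs T0] lt0.
  case El: (V n s) Vs => [//|a l] [eaj]; rewrite eaj in El.
  apply: not_WP_barrier El _ _; first exact: nth_ord.
  apply/negP => wp; have: nth s ord 0 \in WP_targets s ord (V n) j.
    by rewrite mem_filter wp mem_nth.
  by rewrite T0.
case=> ltm [[jG jm]|[jF [n [l [ts [Vs ET]]]]]] ltm1; last first.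
  apply: not_WP_barrier Vs _ _; first exact: nth_ord.
  (* Coming after the greedy choice, the next stack refused [j] at the moment of its move. *)
  exact: after_last_filter ord_uniq ET ltm1.
(* The sorting refers to the configuration before any move, so the block found in the next stack
   belongs to [G]. *)
case: hord => _ /(sortedP s)/(_ m ltm1) le_prio.
have: stack_priority K (nth s ord m.+1) <= j.
  apply: leq_trans le_prio _; rewrite stack_priority_leq.
  by apply/hasP; exists j => //; rewrite mem_keep_other ?nth_ord // jG.
rewrite stack_priority_leq => /hasP[k]; rewrite mem_keep_other ?nth_ord //.
by case/andP=> kG km le_kj; exists k; right.
Qed.

(** The [last_pick] clause is what the next pick needs; the order by [pick_lt] serves the final P8
    argument. *)
Lemma picks_inv ps : picks C s ord F G ps ->
  [/\ exists ps' j, ps = rcons ps' j /\ last_pick (size ps') j,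
      sorted pick_lt ps & {subset ps <= F :|: G}].
Proof.
elim=> {ps} [j hj|ps j k _ [[ps' [j' [/rcons_inj[<- <-] hj]]] sps sub] lt_ps
    hk].
  split=> //; first by exists [::], j.
  by move=> x; rewrite inE => /eqP ->; apply: (@last_pick_mem 0).
have [jk ok] := barrier_inP (nth_ord lt_ps) (last_pick_G hj lt_ps) hk.
have hk' : last_pick (size (rcons ps j)) k by rewrite size_rcons.
split; first by exists (rcons ps j), k.
  case: ps sps {sub lt_ps hk ok hj hk'} => /= [|a ps]; first by rewrite jk.
  by rewrite !rcons_path last_rcons jk => ->.
move=> x; rewrite mem_rcons inE => /orP[/eqP->|/sub //].
exact: last_pick_mem hk'.
Qed.

Lemma first_pick_exists : exists j, picks C s ord F G [:: j].
Proof.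
have sord : s \notin ord by rewrite mem_ord eqxx.
have [[n [j hj]]|[dest hdest]] := stuck_or_all_WP sord
    (keep_disjoint (F :|: G) (initial_config_disjoint hC)).
  by exists j; constructor; exists n.
(* P8 forbids an experiment in which all of [F] becomes WP. *)
case: hP8 => _ _ _ _ /(_ dest)[b bF|b bF].
  by case: (hdest b); rewrite ?mem_keep_s.
by case: (hdest b); rewrite ?mem_keep_s // /WP => _ /negPf ->.
Qed.

Lemma next_pick_exists ps : picks C s ord F G ps -> size ps < S ->
  exists k, picks C s ord F G (rcons ps k).
Proof.
move=> hps; have [[ps' [j [eps hj]]] _ _] := picks_inv hps.
rewrite eps in hps * => lt_ps.
have {}lt_ps : size ps' < size ord.
  by rewrite -ltnS size_ord -(size_rcons ps' j).
have [k hk] := last_pick_barrier hj lt_ps.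
by exists k; apply: Pick_next.
Qed.

Lemma picks_of_size n :
  n < S -> exists2 ps, picks C s ord F G ps & size ps = n.+1.
Proof.
elim: n => [_|n IHn lt_n].
  by have [j hj] := first_pick_exists; exists [:: j].
have [ps hps sz] := IHn (ltnW lt_n).
have [k hk] : exists k, picks C s ord F G (rcons ps k).
  by apply: next_pick_exists; rewrite ?sz.
by exists (rcons ps k); rewrite ?size_rcons ?sz.
Qed.

(** * P8 for the picked blocks *)

Lemma picks_P8 ps : picks C s ord F G ps -> size ps = S ->
  [/\ #|[set b in ps]| = S, [set b in ps] \subset F :|: G
    & P8 C i s (F :&: [set b in ps]) (G :&: [set b in ps])].
Proof.
move=> hps szps; have [_ sps sub] := picks_inv hps.
(* Two picks that meet on one stack need not be consecutive, hence the passage to all pairs. *)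
have pps : pairwise pick_lt ps by rewrite -(sorted_pairwise pick_lt_trans).
have ups : uniq ps.
  by apply: (sorted_uniq pick_lt_trans) sps => x; rewrite /pick_lt ltnn.
case: hP8 => is_s hF hG hG1 _.
split; first by rewrite cardsE (card_uniqP ups).
  by apply/subsetP => b; rewrite inE => /sub.
split=> //.
- by move=> b; rewrite inE => /andP[/hF].
- by move=> b; rewrite inE => /andP[/hG].
- move=> t /hG1; apply: leq_trans; apply: subset_leq_card.
  by apply/subsetP => b; rewrite !inE => /andP[/andP[-> _] ->].
move=> dest hdest; set K' := keep C _.
have [_ dC] := initial_config_disjoint hC.
have mK' t b : (b \in K' t) = (b \in ps) && (b \in C t).
  rewrite mem_filter !inE -andb_orl -in_setU.
  by case: (boolP (b \in ps)) => [/sub ->|]; rewrite ?andbF.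
(* Pigeonhole: loc sends the S picked blocks into the S - 1 other stacks. *)
pose loc x := if x \in F then dest x else odflt s [pick t | x \in C t].
(* The default [s] in [loc] is never reached, since every block lies in some stack. *)
have locG x : x \notin F -> x \in C (loc x).
  move=> /negPf xF; rewrite /loc xF; case: pickP => //= none.
  by have [t xt] := initial_config_mem x hC; rewrite none in xt.
have loc_ord : {subset map loc ps <= ord}.
  move=> t /mapP[x xps ->]; rewrite mem_ord.
  case: (boolP (x \in F)) => xF.
    by rewrite /loc xF; apply: hdest; rewrite !inE xF.
  have := sub _ xps; rewrite inE (negPf xF) => /G_notin_s.
  by apply: contraNneq => <-; apply: locG.
have: ~~ uniq (map loc ps).
  apply/negP => /uniq_leq_size/(_ loc_ord).
  by rewrite size_map szps -[X in X <= _]size_ord ltnn.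
(* With [a < b], the block [x] is picked before [y], so it has the larger label. *)
case/(uniqPn s) => a [b []]; rewrite size_map => lt_ab lt_b.
have lt_a := ltn_trans lt_ab lt_b.
rewrite !(nth_map i) //; set x := nth i ps a; set y := nth i ps b => eq_loc.
have xps : x \in ps by rewrite mem_nth.
have yps : y \in ps by rewrite mem_nth.
have /andP[lt_yx /implyP yF] : pick_lt x y by apply: (pairwiseP i pps).
have xFBP : x \in F -> above (experiment s dest K') (dest x) x y ->
  exists2 b, b \in F :&: [set b in ps] & BP (experiment s dest K') b.
  move=> xF axy; exists x; first by rewrite !inE xF.
  by apply/existsP; exists (dest x); apply/existsP; exists y; rewrite axy.
have uK' : uniq (K' s).
  by apply: filter_uniq; case: (initial_config_disjoint hC).
have ndx : x \in F -> dest x != s by move=> xF; apply: hdest; rewrite !inE xF.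
case: (boolP (y \in F)) => [yinF|yNF].
  have /andP[xF ayx] := yF yinF; apply: (xFBP xF).
  move: eq_loc; rewrite /loc xF yinF => eq_d.
  apply: above_experiment => //; first exact: ndx.
  have xK : x \in K' s by rewrite mK' xps F_in_s.
  have yK : y \in K' s by rewrite mK' yps F_in_s.
  by rewrite /above xK yK ltn_index_filter //; case/and3P: ayx.
have yG : y \in G by have := sub _ yps; rewrite inE (negPf yNF).
have yloc := locG _ yNF.
(* If [x] moves, it lands above the unmoved [y]. If neither moves, both lie in one stack of [C],
   which holds at most one block of [G]. *)
case: (boolP (x \in F)) => [xF|xNF].
  apply: (xFBP xF); move: eq_loc; rewrite {1}/loc xF => eq_d.
  apply: above_experiment_initial; first exact: ndx.
  - by rewrite mK' xps F_in_s.
  - by rewrite mK' (negPf (G_notin_s yG)) andbF.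
  - by rewrite mK' yps eq_d.
have xG : x \in G by have := sub _ xps; rewrite inE (negPf xNF).
have nls : loc y != s by rewrite -mem_ord loc_ord // map_f.
have /card_le1_eqP/(_ x y) := hG1 _ nls.
rewrite !inE xG yG yloc -eq_loc locG // => /(_ isT isT) exy.
by rewrite exy ltnn in lt_yx.
Qed.

End Verification.

Theorem mainTheorem13 (S B : nat) (C : config S B) (i : 'I_B) (s : 'I_S)
    (F G : {set 'I_B}) (ord : seq 'I_S)
    (hC : initial_config C)
    (hP8 : P8 C i s F G)
    (hord : sorted_stacks (keep C (F :|: G)) s ord) :
  [/\ exists j : 'I_B, picks C s ord F G [:: j],
      forall ps : seq 'I_B, picks C s ord F G ps -> size ps < S ->
        exists k : 'I_B, picks C s ord F G (rcons ps k),
      exists2 ps : seq 'I_B, picks C s ord F G ps & size ps = S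
    & forall ps : seq 'I_B, picks C s ord F G ps -> size ps = S ->
        [/\ #|[set b in ps]| = S,
            [set b in ps] \subset F :|: G
          & P8 C i s (F :&: [set b in ps]) (G :&: [set b in ps])]].
Proof.
split; first exact: first_pick_exists hC hP8 hord.
- exact: next_pick_exists hC hP8 hord.
(* The index is [size ord], that is [S - 1], because [picks_of_size] produces one more pick than its
   index. *)
- have [|ps hps szps] := @picks_of_size _ _ _ _ _ _ _ _ hC hP8 hord (size ord).
    by rewrite (size_ord hord).
  by exists ps; rewrite // szps (size_ord hord).
- exact: picks_P8 hC hP8 hord.
Qed.
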